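(* For every integer $q\ge 5$, $f(3,q)>\frac{3}{4}\,2^q\,q!+2q-4$.
   Context: A word over an alphabet is a finite string of letters; a subword of $w$ is a string of consecutive letters of $w$. A word $w$ contains a pattern $P$ if there is a map assigning to each letter of $P$ a nonempty word (different letters may receive equal words) such that the word obtained from $P$ by replacing each letter by its assigned word is a subword of $w$. $Z_3=x_1x_2x_1x_3x_1x_2x_1$. $f(3,q)$ denotes the smallest integer such that every word of length $f(3,q)$ over an alphabet of size $q$ contains $Z_3$. *)

(* Defs.v *)
From mathcomp Require Import all_boot.
From mathcomp Require Import boolp.

Set Implicit Arguments.
Unset Strict Implicit.
Unset Printing Implicit Defensive.

Definition contains (L A : eqType) (P : seq L) (w : seq A) : Prop :=
  exists phi : L -> seq A,
    (forall x, x \in P -> phi x != [::]) /\ infix (flatten (map phi P)) w.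

Definition Z3 : seq nat := [:: 1; 2; 1; 3; 1; 2; 1].

Definition forces_Z3 (q n : nat) : Prop :=
  forall w : seq 'I_q, size w = n -> contains Z3 w.

(* Zimin's theorem for Z3, needed for f3 to be well defined: if words of length
   n all contain P and z does not occur in P, then two of the #|A| ^ n + 1
   blocks of a long enough word coincide, which gives an occurrence of P z P. *)
Lemma forces_step (L : eqType) (A : finType) (P : seq L) (z : L) (n : nat) :
    z \notin P ->
    (forall w : seq A, size w = n -> contains P w) ->
  forall w : seq A, size w = (#|A| ^ n).+1 * n.+1 -> contains (P ++ z :: P) w.
Proof.
move=> zP Pn w sw; set N := (#|A| ^ n).+1 in sw.
have bsz (i : 'I_N) : size (take n (drop (i * n.+1) w)) == n.
  rewrite size_take size_drop sw -mulnBl.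
  have h : n < (N - i) * n.+1 by rewrite leq_pmull // subn_gt0.
  by rewrite h.
pose blk (i : 'I_N) := Tuple (bsz i).
have [i [j ltij eqb]] : exists i : 'I_N, exists2 j : 'I_N, i < j & blk i = blk j.
  have /injectivePn[i [j neij eqb]] : ~~ injectiveb blk.
    apply/injectiveP => /leq_card.
    by rewrite card_ord card_tuple ltnn.
  case: (ltngtP i j) => [lt|lt|/val_inj e]; first by exists i, j.
    by exists j, i.
  by rewrite e eqxx in neij.
move/(congr1 val): eqb => /= eqb.
have := bsz i; set b := take n _ in eqb * => /eqP szb.
have [pre [mid [post [mid0 ew]]]] :
    exists pre mid post, mid != [::] /\ w = pre ++ b ++ mid ++ b ++ post.
  pose d := j * n.+1 - (n + i * n.+1).
  have le : n + i * n.+1 < j * n.+1.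
    by rewrite -addSn -mulSn leq_mul.
  exists (take (i * n.+1) w), (take d (drop (n + i * n.+1) w)),
    (drop n (drop (j * n.+1) w)); split.
    rewrite -size_eq0 size_take size_drop sw -lt0n.
    have hd : 0 < d by rewrite subn_gt0.
    case: ifP => // _; rewrite subn_gt0 (ltn_trans le) //.
    by rewrite ltn_pmul2r.
  have ej : drop (j * n.+1) w = drop d (drop (n + i * n.+1) w).
    by rewrite drop_drop subnK // ltnW.
  rewrite {2}eqb cat_take_drop ej cat_take_drop /b -drop_drop.
  by rewrite !cat_take_drop.
have [phi [phi0 /infixP[s [t eb]]]] := Pn b szb.
exists (fun x => if x == z then t ++ mid ++ s else phi x); split.
  move=> x; case: (x =P z) => [_ _|/eqP nx].
    by case: (t) => //=; case: (mid) mid0.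
  by rewrite mem_cat inE (negPf nx) /= orbb; apply: phi0.
have eP : [seq (if x == z then t ++ mid ++ s else phi x) | x <- P]
        = [seq phi x | x <- P].
  by apply/eq_in_map => x xP; case: (x =P z) => // e; rewrite -e xP in zP.
apply/infixP; exists (pre ++ s), (t ++ post).
by rewrite ew map_cat /= eqxx eP flatten_cat /= eb -!catA.
Qed.

Lemma forces_Z3_ex (q : nat) : exists n, `[< forces_Z3 q n >].
Proof.
have H0 (w : seq 'I_q) : size w = 0 -> contains ([::] : seq nat) w.
  by move=> _; exists (fun=> [::]); split=> //; apply: infix0s.
have H1 := @forces_step _ _ [::] 1 _ (erefl _) H0.
have H2 := @forces_step _ _ [:: 1] 2 _ (erefl _) H1.
have H3 := @forces_step _ _ [:: 1; 2; 1] 3 _ (erefl _) H2.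
by eexists; apply/asboolP; exact: H3.
Qed.

Definition f3 (q : nat) : nat := ex_minn (forces_Z3_ex q).

(* Main.v *)
(** A [Z3]-free word of length [3/4 2^q q! + 2q - 4] is built from runs of one or
    two equal letters.  The windows of [q - 1] consecutive runs with distinct
    letters form a finite set of [q! 2^(q-1)] elements; each can be followed by
    a run whose letter is either the oldest letter of the window (then single)
    or the missing one (then doubled).  This 2-in 2-out digraph is connected,
    hence has an Eulerian tour, i.e. a cyclic ordering of all windows.  Read
    along that tour the windows give a run sequence in which each window occurs
    once; runs have average length 3/2, and the first [q - 2] runs, repeated at
    the end, are chosen doubled.  If [X Y X] occurs at two places, it spans at
    least [q] consecutive runs, of which the [q - 2] inner ones at least are
    complete; their letters and lengths together with the two outer letters
    determine a window, so the two places coincide. *)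

Require Import Defs.
From mathcomp Require Import all_boot all_order all_algebra all_fingroup.
From mathcomp Require Import boolp zify lra.
Import Order.TTheory GRing.Theory Num.Theory.

Set Implicit Arguments.
Unset Strict Implicit.
Unset Printing Implicit Defensive.

(** * Merging the cycles of a permutation *)

Section MergeCycles.
Variables (T : finType) (s0 : {perm T}) (fl : T -> T).
Hypothesis flK : involutive fl.
Hypothesis connected : forall A : {set T}, A != set0 ->
  (forall x, x \in A -> s0 x \in A) -> (forall x, x \in A -> fl x \in A) ->
  A = [set: T].

(* Among the permutations sending each [x] to [s0 x] or [s0 (fl x)], one with
   the fewest cycles has a single cycle: if [x] and [fl x] were in different
   cycles, composing with their transposition would merge these. *)
Lemma exists_full_cycle :
  exists2 s : {perm T}, forall x, s x = s0 x \/ s x = s0 (fl x)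
                      & forall x, porbit s x = [set: T].
Proof.
pose ok (s : {perm T}) := [forall x, (s x == s0 x) || (s x == s0 (fl x))].
have ok0 : ok s0 by apply/forallP => x; rewrite eqxx.
case: (arg_minnP (fun s => #|porbits s|) ok0) => s /forallP oks mins.
have okP x : s x = s0 x \/ s x = s0 (fl x).
  by case/orP: (oks x) => /eqP; [left | right].
have flP y : y \in porbit s (fl y).
  apply/negPn/negP => nfl; have := porbits_mul_tperm s y (fl y).
  rewrite /= nfl; have /mins : ok (tperm y (fl y) * s)%g.
    apply/forallP => z; rewrite permM; case: tpermP => [->|->|_ _] //.
      by have := oks (fl y); rewrite flK orbC.
    by have := oks y; rewrite flK orbC.
  by case: (y != _) => /=; lia.
exists s => // x; apply: connected => [|y yx|y yx].
- by apply/set0Pn; exists x; rewrite porbit_id.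
- have sP z : (s z \in porbit s x) = (z \in porbit s x).
    by rewrite -!eq_porbit_mem -[s z]/((s ^+ 1)%g z) porbit_perm.
  have flyx : fl y \in porbit s x.
    by move: yx; rewrite -!eq_porbit_mem => /eqP <-; rewrite eq_porbit_mem -{2}[y]flK.
  case: (okP y) => [<-|e1]; first by rewrite sP.
  case: (okP (fl y)) => [e2|]; last by rewrite flK => <-; rewrite sP.
  have -> : y = fl y by apply: (@perm_inj _ s); rewrite e1.
  by rewrite -e2 sP.
- by move: yx; rewrite -!eq_porbit_mem => /eqP <-; rewrite eq_porbit_mem -{2}[y]flK.
Qed.
End MergeCycles.

(** * Connectedness of the digraph of windows *)

Section Graph.
Variable n : nat.
Local Open Scope group_scope.

(* The window [(p, m)] consists of runs of letters [p 0, ..., p n], the [i]-th of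
   them doubled iff [m] has bit [i]; [p ord_max] is the missing letter. *)
Let edge : Type := ('S_n.+2 * n.+1.-tuple bool)%type.

Definition rotp : 'S_n.+2 := perm (addrI (1%R : 'I_n.+2)).
(** Products of permutations act from left to right, so [shiftp c * p] reads [p] at shifted indices:
    of [p ord0] and [p ord_max], one becomes the letter of the new run and the other the missing
    letter. *)
Definition shiftp (c : bool) : 'S_n.+2 :=
  if c then rotp else tperm (inord n) ord_max * rotp.

Lemma shiftpE c (i : 'I_n.+2) : i < n -> shiftp c i = inord i.+1.
Proof.
move=> lti; have rE : rotp i = inord i.+1.
  apply: val_inj; rewrite permE /= inordK; last lia.
  by rewrite [1 %% _]modn_small // add1n modn_small //; lia.
case: c => //=; rewrite permM tpermD //.
  by apply: contraTneq lti => <-; rewrite inordK; lia.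
by apply: contraTneq lti => <- /=; lia.
Qed.

Lemma shiftp_last c : shiftp c (inord n) = if c then ord_max else ord0.
Proof.
case: c; rewrite /= ?permM ?tpermL permE; apply: val_inj => /=.
  by rewrite inordK; [rewrite [1 %% _]modn_small // add1n modn_small | lia].
by rewrite [1 %% _]modn_small // add1n modnn.
Qed.

(** Cancelling the full cycle [rotp] from [shiftp false] leaves a transposition of two cyclically
    adjacent points. *)
Lemma gen_shiftp : <<[set shiftp true; shiftp false]>> = [set: 'S_n.+2].
Proof.
apply/eqP; rewrite eqEsubset subsetT /=.
have co : coprime n.+2 (ord_max - inord n : 'I_n.+2)%R.
  rewrite /= inordK; last lia.
  have -> : n.+1 + (n.+2 - n) %% n.+2 = n.+1 + 2 %[mod n.+2].
    by rewrite modnDmr; congr (_ %% _); lia.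
  by rewrite (_ : n.+1 + 2 = n.+2 + 1) ?modnDl ?modn_small ?coprimen1 //; lia.
rewrite -(gen_tpermn_circular_shift co) gen_subG -/rotp.
have r1 : rotp \in <<[set shiftp true; shiftp false]>>.
  by rewrite mem_gen ?inE ?eqxx.
apply/subsetP => s /[!inE] /orP[]/eqP-> //.
rewrite -(groupMr _ r1); apply: mem_gen.
by rewrite !inE eqxx orbT.
Qed.

(* A new run is doubled iff its letter is the missing one; the choice between
   the two successors of [e] is read off its oldest bit, which they forget. *)
Definition next0 (e : edge) : edge :=
  (shiftp (thead e.2) * e.1, [tuple of rcons (behead e.2) (thead e.2)]).
Definition flip (e : edge) : edge :=
  (e.1, [tuple of ~~ thead e.2 :: behead e.2]).

Lemma flipK : involutive flip.
Proof.
case=> p m; case/tupleP: m => b m; congr pair.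
by apply: val_inj; rewrite /= !theadE negbK.
Qed.

Lemma next0_inj : injective next0.
Proof.
case=> p m [p' m'] []; case/tupleP: m => b m; case/tupleP: m' => b' m'.
rewrite /= !theadE => ep /rcons_inj[em eb]; congr pair.
  by move: ep; rewrite eb => /mulgI.
by apply: val_inj; rewrite /= eb em.
Qed.

(** The permutations whose left multiplication preserves the set of first components of [A] form a
    group containing both [shiftp c], so every permutation is a first component. *)
Lemma graph_connected (A : {set edge}) : A != set0 ->
  (forall e, e \in A -> next0 e \in A) -> (forall e, e \in A -> flip e \in A) ->
  A = [set: edge].
Proof.
move=> /set0Pn[[p0 m0] A0] Anext Aflip.
pose app c (m : n.+1.-tuple bool) := [tuple of rcons (behead m) c].
have Astep c p m : (p, m) \in A -> (shiftp c * p, app c m) \in A.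
  move=> Apm; have := Anext _ Apm; have := Anext _ (Aflip _ Apm).
  case/tupleP: m {Apm} => b m; rewrite /next0 /flip /= !theadE.
  case: (b =P c) => [->|/eqP bc] H1 H2.
    by congr (_ \in A): H2; congr pair; apply: val_inj.
  have ebc : ~~ b = c by case: b c bc {H1 H2} => [] [].
  by congr (_ \in A): H1; congr pair; rewrite ebc //; apply: val_inj.
pose H := [set g | [forall p, [exists m, (p, m) \in A] ==>
   [exists m, (g * p, m) \in A]]].
have HP g p m : g \in H -> (p, m) \in A -> exists m', (g * p, m') \in A.
  rewrite inE => /forallP/(_ p)/implyP h Apm; apply/existsP/h.
  by apply/existsP; exists m.
have gH : group_set H.
  apply/group_setP; split=> [|g h gH hH]; rewrite inE.
    by apply/forallP => p; rewrite mul1g; apply/implyP.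
  apply/forallP => p; apply/implyP => /existsP[m Apm].
  have [m1 A1] := HP _ _ _ hH Apm; have [m2 A2] := HP _ _ _ gH A1.
  by apply/existsP; exists m2; rewrite -mulgA.
have HT : Group gH :=: [set: 'S_n.+2].
  apply/eqP; rewrite eqEsubset subsetT -gen_shiftp gen_subG.
  have sH c : shiftp c \in H.
    rewrite inE; apply/forallP => p; apply/implyP => /existsP[m Apm].
    by apply/existsP; exists (app c m); apply: Astep.
  by apply/subsetP => _ /set2P[] ->; apply: sH.
have Aall p : exists m, (p, m) \in A.
  have := HP (p * p0^-1) p0 m0; rewrite mulgKV; apply=> //.
  by rewrite -[H]/(gval (Group gH)) HT inE.
(* Appending the bits of [m] one by one forces the second component, whatever
   it was before, and multiplies the first one by a fixed permutation. *)
have Aseq (s : seq bool) : exists g : 'S_n.+2, forall p m, (p, m) \in A ->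
    exists2 m' : n.+1.-tuple bool, (g * p, m') \in A &
      tval m' = drop (size s) (tval m ++ s).
  elim/last_ind: s => [|s c [g IH]].
    by exists 1 => p m Apm; exists m; rewrite ?mul1g // cats0 drop0.
  exists (shiftp c * g) => p m /IH[m' Am' em']; exists (app c m').
    by rewrite -mulgA; apply: Astep.
  rewrite /= em' size_rcons -rcons_cat -drop1 drop_drop add1n drop_rcons //.
  by rewrite size_cat size_tuple; lia.
apply/setP => -[p m]; rewrite inE.
have [g gP] := Aseq m; have [m1 /gP[m' Am' em']] := Aall (g^-1 * p).
rewrite mulKVg in Am'; have <- // : m' = m.
by apply: val_inj; rewrite /= em' size_tuple drop_size_cat ?size_tuple.
Qed.
End Graph.

(** * Repeated stretches in a word, and its division into runs *)

Lemma contains_Z3_repeat (A : eqType) (x0 : A) (w : seq A) : contains Z3 w ->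
  exists i j l, [/\ 1 < l, i + l < j, j + l < size w,
    nth x0 w i = nth x0 w (i + l)
    & forall t, t <= l -> nth x0 w (i + t) = nth x0 w (j + t)].
Proof.
case=> phi [phi0 /infixP[s [s' ->]]] /=.
have n0 k : k \in Z3 -> 0 < size (phi k) by rewrite lt0n size_eq0; apply: phi0.
have n1 := n0 1 isT; have n2 := n0 2 isT; have n3 := n0 3 isT.
move: (phi 1) (phi 2) (phi 3) n1 n2 n3 => X Y Z n1 n2 n3.
pose V := X ++ Y ++ X; pose w' := s ++ V ++ Z ++ V ++ s'.
rewrite (_ : s ++ _ = w'); last by rewrite /w' /V !cats0 -!catA.
have VE t u v : t < size V -> nth x0 (u ++ V ++ v) (size u + t) = nth x0 V t.
  by move=> lt; rewrite nth_cat ltnNge leq_addr /= addKn nth_cat lt.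
have w1 t : t < size V -> nth x0 w' (size s + t) = nth x0 V t by apply: VE.
have w2 t : t < size V ->
    nth x0 w' (size s + size V + size Z + t) = nth x0 V t.
  move=> lt; rewrite /w' -(VE t (s ++ V ++ Z) s' lt) !size_cat.
  by rewrite -!catA !addnA.
have sV : size V = size X + size Y + size X by rewrite !size_cat addnA.
(* With [l] the length of [XY], only the first letter of the second [X] is kept. *)
exists (size s), (size s + size V + size Z), (size X + size Y); split.
- lia.
- lia.
- rewrite !size_cat; lia.
- rewrite -{1}[size s]addn0 !w1; try lia.
  rewrite /V nth_cat n1 catA nth_cat size_cat ltnn subnn.
  by case: (X) n1.
- by move=> t let_; rewrite w1 ?w2 //; lia.
Qed.

Section Runs.
Variable b : nat -> bool.

(* Position [i] of the word whose [t]-th run has length [(b t).+1] lies in the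
   run [run i], and [second i] tells whether it is the second letter of it. *)
Definition run_state (i : nat) : nat * bool :=
  iter i (fun y => if b y.1 && ~~ y.2 then (y.1, true) else (y.1.+1, false))
    (0, false).
Definition run i := (run_state i).1.
Definition second i := (run_state i).2.
Definition run_start t := \sum_(u < t) (b u).+1.

Lemma run_startS t : run_start t.+1 = run_start t + (b t).+1.
Proof. by rewrite /run_start big_ord_recr. Qed.

Lemma leq_run_start t u : t <= u -> run_start t + (u - t) <= run_start u.
Proof.
elim: u => [|u IH]; first by rewrite leqn0 => /eqP->; rewrite addn0.
rewrite leq_eqVlt => /orP[/eqP->|/IH]; first by rewrite subnn addn0.
by rewrite run_startS; lia.
Qed.

Lemma run_stateP i :
  i = run_start (run i) + second i /\ (second i -> b (run i)).
Proof.
elim: i => [|i]; rewrite /run /second /=; first by rewrite /run_start big_ord0.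
case: (run_state i) => t c /= [-> bc].
case: c bc => [/(_ isT) bt|_] /=; rewrite ?andbF ?andbT ?run_startS ?bt.
  by split=> //=; lia.
by case: (boolP (b t)) => bt /=; rewrite ?run_startS ?(negPf bt); split=> //; lia.
Qed.

Lemma run_bounds i :
  [/\ run_start (run i) <= i, i <= (run_start (run i)).+1
    & i < run_start (run i).+1].
Proof.
have [e bP] := run_stateP i; rewrite run_startS; split; lia.
Qed.

Lemma run_lt i t : (run i < t) = (i < run_start t).
Proof.
have [h1 h2 h3] := run_bounds i; apply/idP/idP => [/leq_run_start|]; first lia.
by move=> lti; rewrite ltnNge; apply/negP => /leq_run_start; lia.
Qed.

Lemma run_run_start t : run (run_start t) = t.
Proof.
have := run_lt (run_start t) t; have := run_lt (run_start t) t.+1.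
rewrite run_startS; lia.
Qed.

Lemma runS i : run i.+1 = run i \/ run i.+1 = (run i).+1.
Proof.
rewrite /run /=; case: (run_state i) => t c /=.
by case: ifP => _ /=; [left | right].
Qed.

Lemma run_start_next t : (run (run_start t).+1 == t) = b t.
Proof.
have := run_lt (run_start t).+1 t; have := run_lt (run_start t).+1 t.+1.
by rewrite run_startS; case: (b t); lia.
Qed.

End Runs.

(** * Avoidance of [Z3] by a sequence of runs *)

Section Avoid.
Variables (L : eqType) (x : nat -> L) (b : nat -> bool) (n M : nat).
Hypothesis n0 : 0 < n.
Hypothesis distinct : forall t k, 0 < k <= n -> x t != x (t + k).
Hypothesis determined : forall r r', r + n.+1 < M -> r' + n.+1 < M ->
  (forall k, k <= n.+1 -> x (r + k) = x (r' + k)) ->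
  (forall k, 0 < k <= n -> b (r + k) = b (r' + k)) -> r = r'.

Let y i := x (run b i).

(** A run has at most two letters, so the two positions lie in different runs, and runs with equal
    letters are more than [n] apart. *)
Let run_repeat i l : 1 < l -> y i = y (i + l) -> run b i + n.+1 <= run b (i + l).
Proof.
move=> l1 ey; have [h1 h2 h3] := run_bounds b i.
have [h1' h2' h3'] := run_bounds b (i + l).
have ltr : run b i < run b (i + l).
  rewrite ltnNge; apply/negP => /(leq_run_start b); lia.
rewrite leqNgt; apply/negP => lt.
have := distinct (run b i) (k := run b (i + l) - run b i).
rewrite subnKC ?(ltnW ltr) // => d; have : y i != y (i + l) by apply: d; lia.
by rewrite ey eqxx.
Qed.

Let run_step i : run b i.+1 = run b i + (y i != y i.+1).
Proof.
rewrite /y; case: (runS b i) => ->; first by rewrite eqxx addn0.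
by rewrite -addn1 distinct.
Qed.

Lemma runs_avoid_Z3 : ~ contains Z3 (mkseq y (run_start b M)).
Proof.
move=> /(contains_Z3_repeat (x 0)); rewrite size_mkseq.
case=> i [j [l [l1 ltj jM]]]; rewrite !nth_mkseq; try lia; move=> eil eij.
have {}eij t : t <= l -> y (i + t) = y (j + t).
  by move=> tl; have := eij t tl; rewrite !nth_mkseq //; lia.
have ejl : y j = y (j + l) by rewrite -eij // -eil -[i]addn0 eij // addn0.
have ri := run_repeat l1 eil; have rj := run_repeat l1 ejl.
have riM : run b (i + l) < M by rewrite run_lt; lia.
have rjM : run b (j + l) < M by rewrite run_lt.
(* A new run begins exactly where the letter changes, so equal stretches have run boundaries at the
   same offsets. *)
have rshift t : t <= l -> run b (j + t) + run b i = run b (i + t) + run b j.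
  elim: t => [|t IH] tl; first by rewrite !addn0 addnC.
  rewrite !addnS !run_step -!addnS !eij //; last exact: ltnW.
  by have := IH (ltnW tl); lia.
have [b1 b2 b3] := run_bounds b i.
have [c1 c2 c3] := run_bounds b (i + l).
have start k : k <= n.+1 -> 0 < k ->
    exists2 t, t < l & run_start b (run b i + k) = i + t.+1.
  move=> kn k0; exists (run_start b (run b i + k) - i).-1.
    have := @leq_run_start b (run b i + k) (run b (i + l)); lia.
  have := @leq_run_start b (run b i).+1 (run b i + k); lia.
have startj k t : t < l -> run_start b (run b i + k) = i + t.+1 -> 0 < k ->
    run_start b (run b j + k) = j + t.+1.
  move=> tl et k0.
  have h1 : run b (i + t.+1) = run b i + k by rewrite -et run_run_start.
  have h2 : run b (i + t) < run b i + k by rewrite run_lt; lia.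
  have := rshift _ tl; have := rshift _ (ltnW tl); rewrite h1 => e1 e2.
  have : run b (j + t) < run b j + k by lia.
  have : ~~ (run b (j + t.+1) < run b j + k) by lia.
  by rewrite !run_lt; lia.
(* Equality is absurd: the run of [i + l] is at least [n.+1] runs after that of [i], yet not after
   that of [j]. *)
suff : run b i = run b j.
  have : run b (i + l) <= run b j.
    rewrite leqNgt run_lt -leqNgt; lia.
  lia.
apply: determined; try lia.
- move=> [|k] kn.
    by rewrite !addn0 -[LHS]/(y i) -[RHS]/(y j) -[i]addn0 eij // addn0.
  have [t tl et] := start k.+1 kn isT.
  have et' := startj _ _ tl et isT.
  rewrite -[run b i + _](run_run_start b) -[run b j + _](run_run_start b).
  by rewrite et et'; apply: eij.
- move=> k /andP[k0 kn].
  have [t tl et] := start k (leqW kn) k0.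
  have et' := startj _ _ tl et k0.
  (* For [k <= n] the next run also starts by offset [l], so the length of run [k] is visible in
     both stretches. *)
  have tl2 : t.+2 <= l.
    have := @leq_run_start b (run b i + k).+1 (run b (i + l)).
    by rewrite run_startS; lia.
  rewrite -!(run_start_next b) et et' -!addnS.
  by have := rshift _ tl2; lia.
Qed.
End Avoid.

(** * The word read along the tour, and the bound *)

Lemma perm_eq_but_one (T : finType) (z : T) (p p' : {perm T}) :
  (forall i, i != z -> p i = p' i) -> p = p'.
Proof.
move=> e; apply/permP => i; have [-> | /e //] := eqVneq i z.
have [j ej] : exists j, p z = p' j by exists (p'^-1 (p z))%g; rewrite permKV.
have [ejz | /e ejz] := eqVneq j z; first by rewrite ej ejz.
by move: ej; rewrite -ejz => /perm_inj->.
Qed.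

Lemma nth_rcons_behead (k m : nat) (c : bool) (u : k.+1.-tuple bool) :
  m <= k -> nth false (rcons (behead u) c) m =
            if m < k then nth false u m.+1 else c.
Proof.
move=> mk; rewrite nth_rcons size_behead size_tuple /= nth_behead.
by case: ltngtP mk.
Qed.

Lemma long_Z3_free_word (n : nat) : 0 < n -> exists2 w : seq 'I_n.+2,
  (size w).*2 = 3 * (n.+2`! * 2 ^ n.+1) + 4 * n & ~ contains Z3 w.
Proof.
move=> n0; pose T : finType := ('S_n.+2 * n.+1.-tuple bool)%type.
have [A A0 As Af|s sP sT] :=
  @exists_full_cycle T (perm (@next0_inj n)) (@flip n) (@flipK n).
  by apply: graph_connected A0 _ Af => y /As; rewrite permE.
pose e0 : T := (1%g, [tuple of nseq n.+1 true]); pose e t := iter t s e0.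
pose N := #|T|.
have eS t : exists c, e t.+1 =
    ((shiftp n c * (e t).1)%g, [tuple of rcons (behead (e t).2) c]).
  rewrite /= -/(e t); case: (e t) => p m.
  case: (sP (p, m)) => ->; rewrite permE /next0 /=; first by exists (thead m).
  by exists (~~ thead m); congr pair; apply: val_inj.
pose x t := (e t).1 ord0; pose b t : bool := thead (e t).2.
have xE t k : k <= n -> (e t).1 (inord k) = x (t + k).
  elim: k t => [|k IH] t kn.
    by rewrite addn0; congr ((e t).1 _); apply: val_inj; rewrite /= inordK.
  have [c ec] := eS t; rewrite addnS -addSn -IH; last exact: ltnW.
  by rewrite ec permM shiftpE inordK //; lia.
have bE t k : k <= n -> nth false (e t).2 k = b (t + k).
  elim: k t => [|k IH] t kn; first by rewrite addn0 /b /thead (tnth_nth false).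
  have [c ec] := eS t; rewrite addnS -addSn -IH; last exact: ltnW.
  by rewrite ec nth_rcons_behead ?kn // ltnW.
(* The letters alone tell whether a run is doubled. *)
have stepE t : (x (t + n.+1) == x t) = ~~ b (t + n.+1).
  have [c ec] := eS t; rewrite addnS -addSn -xE // -bE // ec /=.
  rewrite nth_rcons_behead // ltnn permM shiftp_last.
  by case: c {ec}; rewrite /x ?eqxx // (inj_eq perm_inj).
have eN : e N = e0.
  by have := iter_porbit s e0; rewrite sT cardsT.
have e_inj t t' : t < N -> t' < N -> e t = e t' -> t = t'.
  move=> tN t'N ett'; have := uniq_traject_porbit s e0; rewrite sT cardsT => u.
  apply/eqP; rewrite -(nth_uniq e0 _ _ u) ?size_traject //.
  by rewrite !nth_traject // -/(e t) -/(e t') ett'.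
have distinct t k : 0 < k <= n -> x t != x (t + k).
  move=> /andP[k0 kn]; rewrite -[t in x t]addn0 -!xE // (inj_eq perm_inj).
  by rewrite -val_eqE /= !inordK; lia.
have determined r r' : r + n.+1 < N + n -> r' + n.+1 < N + n ->
    (forall k, k <= n.+1 -> x (r + k) = x (r' + k)) ->
    (forall k, 0 < k <= n -> b (r + k) = b (r' + k)) -> r = r'.
  move=> rN r'N xx bb.
  (* In the window starting at [r.+1], the only bit not given by hypothesis is the last, and [stepE]
     recovers it from the letters of runs [r] and [r + n.+1]. *)
  suff er : e r.+1 = e r'.+1 by apply: succn_inj; apply: e_inj er; lia.
  rewrite (surjective_pairing (e r.+1)) (surjective_pairing (e r'.+1)).
  congr pair.
    apply: (@perm_eq_but_one _ ord_max) => i im.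
    have ltin : i <= n by move: im (ltn_ord i); rewrite -val_eqE /=; lia.
    by rewrite -[i]inord_val !xE // !addSnnS xx.
  apply: val_inj; apply: (@eq_from_nth _ false); rewrite !size_tuple // => i.
  rewrite ltnS => ltin; rewrite !bE // !addSnnS.
  move: ltin; rewrite leq_eqVlt => /orP[/eqP->|ltin]; last by apply: bb; lia.
  have xr : x r = x r' by have := xx 0 isT; rewrite !addn0.
  by apply: negb_inj; rewrite -!stepE xx // xr.
exists (mkseq (fun i => x (run b i)) (run_start b (N + n))); last first.
  exact: (@runs_avoid_Z3 _ x b n (N + n)).
have sumT : (\sum_(t < N) b t).*2 = N.
  have -> : \sum_(t < N) b t = \sum_(y : T) thead y.2.
    rewrite -(big_mkord xpredT (fun t => b t : nat)) /index_iota subn0.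
    have pe : perm_eq (index_enum T) (map e (iota 0 N)).
      apply: uniq_perm; rewrite ?index_enum_uniq //.
        rewrite map_inj_in_uniq ?iota_uniq // => t t'.
        by rewrite !mem_iota => ? ?; apply: e_inj.
      move=> y; rewrite mem_index_enum; symmetry; apply/mapP.
      have : y \in porbit s e0 by rewrite sT inE.
      rewrite porbit_traject sT cardsT => /trajectP[t tN ->].
      by exists t; rewrite ?mem_iota.
    by rewrite (perm_big _ pe) big_map.
  (* [flip] negates the oldest bit, so exactly half of the windows begin with a doubled run. *)
  rewrite -addnn {2}(reindex_inj (inv_inj (@flipK n))) -big_split /=.
  rewrite (eq_bigr (fun=> 1)) ?sum1_card // => y _.
  by rewrite theadE; case: (thead _).
have NE : N = n.+2`! * 2 ^ n.+1.
  by rewrite /N card_prod card_Sn card_tuple card_bool.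
rewrite size_mkseq /run_start big_split_ord /= -NE.
rewrite [X in _ + X](eq_bigr (fun=> 2)) => [|k _].
  rewrite sum_nat_const card_ord.
  under eq_bigr do rewrite -addn1.
  rewrite big_split /= sum_nat_const card_ord.
  by move: sumT; move: (\sum_(t < N) b t) => S; lia.
have bk : b k = true.
  rewrite -[nat_of_ord k]add0n -bE 1?ltnW //.
  by rewrite -[tval (e 0).2]/(nseq n.+1 true) nth_nseq ltnS ltnW.
have eNk : e (N + k) = e k by rewrite /e addnC iterD -/(e N) eN.
by rewrite /b eNk -/(b k) bk.
Qed.

Lemma f3_gt (q : nat) (w : seq 'I_q) : ~ contains Z3 w -> size w < f3 q.
Proof.
move=> nw; rewrite /f3; case: ex_minnP => m /asboolP fm _.
rewrite ltnNge; apply/negP => le; apply: nw.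
have [phi [phi0 h]] := fm (take m w) (size_takel le).
exists phi; split=> //; apply: infix_trans h _.
by apply/infixP; exists [::], (drop m w); rewrite cat_take_drop.
Qed.

Local Open Scope ring_scope.

Theorem theorem5p3 (q : nat) (hq : (5 <= q)%N) :
  3%:R / 4%:R * 2%:R ^+ q * (q`!)%:R + 2%:R * q%:R - 4%:R < (f3 q)%:R :> rat.
Proof.
have [n n0 eq] : exists2 n, (0 < n)%N & q = n.+2 by exists (q - 2)%N; lia.
have [w sw /f3_gt] := long_Z3_free_word n0; rewrite eq -(ltr_nat rat).
(* The length of [w] equals the bound exactly; strictness comes from [f3_gt]. *)
move: (f3 q) => f; apply: le_lt_trans; rewrite le_eqVlt; apply/orP; left.
apply/eqP; move: (size w) n.+2`! sw => c F.
rewrite -mul2n => /(congr1 (fun k => k%:R : rat)).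
rewrite natrD (natrM _ 2 c) (natrM _ 3) (natrM _ F) (natrM _ 4 n) natrX.
have -> : n.+2%:R = n%:R + 2%:R :> rat by rewrite -natrD addn2.
rewrite [2%:R ^+ n.+2]exprS.
move: (2%:R ^+ n.+1) F%:R c%:R n%:R => pow fac len m.
nra.
Qed.
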